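(* Let $H$ be a bialgebra over a field $K$ and let $A$ be an $H$-module-algebra with action map $\lambda$. If both $H^2_h(A,A)$ and $H^1(\mathcal{F}^\bullet(A))$ are trivial, then $A$ is rigid, i.e. every deformation of $A$ is equivalent to the trivial deformation $\Lambda_t=\lambda$.
   Context: Fix a field $K$; $\otimes$ and $\mathrm{Hom}$ are over $K$. $(H,\mu_H,\Delta_H)$ is a $K$-bialgebra; Sweedler notation $\Delta_H(x)=\sum_{(x)} x_{(1)}\otimes x_{(2)}$. $\mathrm{End}(A)$ is the algebra of $K$-linear endomorphisms of $A$. An associative $K$-algebra $A$ is an $H$-module-algebra if it has an $H$-module structure $\lambda\in\mathrm{Hom}(H,\mathrm{End}(A))$ with $\lambda(xy)=\lambda(x)\circ\lambda(y)$ and $\lambda(x)(ab)=\sum_{(x)}\lambda(x_{(1)})(a)\cdot\lambda(x_{(2)})(b)$ for $x,y\in H$, $a,b\in A$. $\mathrm{Der}(A)$ is the space of derivations of $A$. Low degrees of the cochain complex $\mathcal{F}^\bullet(A)$: $\mathcal{F}^0(A)=\mathrm{Der}(A)$, $\mathcal{F}^1(A)=\mathrm{Hom}(H,\mathrm{End}(A))$, $\mathcal{F}^2(A)=\mathrm{Hom}(H^{\otimes2},\mathrm{End}(A))\oplus\mathrm{Hom}(H,\mathrm{Hom}(A^{\otimes2},A))$; $(d^0\varphi)(x)=\lambda(x)\circ\varphi-\varphi\circ\lambda(x)$; $d^1\psi=(d^1_0\psi;d^1_1\psi)$ with $$(d^1_0\psi)(x\otimes y)=\lambda(x)\circ\psi(y)-\psi(xy)+\psi(x)\circ\lambda(y),$$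 $$(d^1_1\psi)(x)(a\otimes b)=\sum_{(x)}\lambda(x_{(1)})(a)\cdot\psi(x_{(2)})(b)-\psi(x)(ab)+\sum_{(x)}\psi(x_{(1)})(a)\cdot\lambda(x_{(2)})(b).$$ $H^1(\mathcal{F}^\bullet(A))=\ker d^1/\mathrm{im}\,d^0$. A deformation of $A$ is a power series $\Lambda_t=\sum_{i\ge0}\lambda_it^i$ with $\lambda_0=\lambda$, each $\lambda_i\in\mathcal{F}^1(A)$, satisfying $\Lambda_t(xy)=\Lambda_t(x)\circ\Lambda_t(y)$ and $\Lambda_t(x)(ab)=\sum_{(x)}\Lambda_t(x_{(1)})(a)\cdot\Lambda_t(x_{(2)})(b)$ for all $x,y\in H$, $a,b\in A$ (as identities of power series in $t$). A formal automorphism of $A$ is a power series $\Phi_t=\sum_{i\ge0}\phi_it^i$ with $\phi_0=\mathrm{Id}_A$, each $\phi_i\in\mathrm{End}(A)$, and $\Phi_t(ab)=\Phi_t(a)\Phi_t(b)$ for all $a,b\in A$. Deformations $\Lambda_t$, $\overline{\Lambda}_t$ are equivalent if $\overline{\Lambda}_t=\Phi_t^{-1}\Lambda_t\Phi_t$ for some formal automorphism $\Phi_t$, where $(\phi_i\lambda_j\phi_k)(x)=\phi_i\circ\lambda_j(x)\circ\phi_k$. $H^\bullet_h(A,A)$ is the Hochschild cohomology of the associative algebra $A$ with coefficients in itself, computed by the complex $C^n_h(A,A)=\mathrm{Hom}(A^{\otimes n},A)$, $n\ge0$, with the usual Hochschild coboundary. *)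

(* Defs.v *)
From HB Require Import structures.
From mathcomp Require Import all_boot all_order all_algebra.
From mathcomp Require Import boolp.
Set Implicit Arguments.
Unset Strict Implicit.
Unset Printing Implicit Defensive.
Import GRing.Theory.
Local Open Scope ring_scope.
Local Open Scope quotient_scope.

(* MathComp has no tensor product of possibly infinite-dimensional spaces.    *)
(* Here a list [:: (v1, w1); ...; (vn, wn)] stands for the sum of the         *)
(* vi (x) wi, and two lists are identified when no bilinear map, into any     *)
(* vector space, distinguishes them. The universal property follows           *)
(* (tensor_ind, tensor_liftE, tensor_lift_linear).                            *)
Section Tensor.
Variables (K : fieldType) (V W : lmodType K).

Definition eval_sum (U : lmodType K) (f : V -> W -> U) (s : seq (V * W)) : U :=
  \sum_(p <- s) f p.1 p.2.

Definition tensor_eq (s t : seq (V * W)) : bool :=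
  `[< forall (U : lmodType K) (f : {bilinear V -> W -> U}),
        eval_sum f s = eval_sum f t >].

Lemma tensor_eq_refl : reflexive tensor_eq.
Proof. by move=> s; apply/asboolP. Qed.

Lemma tensor_eq_sym : symmetric tensor_eq.
Proof. by move=> s t; apply/asboolP/asboolP => e U f; rewrite e. Qed.

Lemma tensor_eq_trans : transitive tensor_eq.
Proof.
by move=> t s r /asboolP e1 /asboolP e2; apply/asboolP => U f; rewrite e1 e2.
Qed.

Canonical tensor_equiv :=
  EquivRel tensor_eq tensor_eq_refl tensor_eq_sym tensor_eq_trans.

Definition tensor := {eq_quot tensor_equiv}.

HB.instance Definition _ := EqQuotient.on tensor.
HB.instance Definition _ := Choice.on tensor.

Definition tens (v : V) (w : W) : tensor := \pi_tensor [:: (v, w)].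

(* Meaningful only for bilinear f; for such f it is the linear map            *)
(* tensor -> U corresponding to f.                                            *)
Definition tensor_lift (U : lmodType K) (f : V -> W -> U) (t : tensor) : U :=
  eval_sum f (repr t).

Definition tadd (s t : tensor) : tensor := \pi_tensor (repr s ++ repr t).
Definition tscale (c : K) (s : tensor) : tensor :=
  \pi_tensor [seq (c *: p.1, p.2) | p <- repr s].
Definition topp : tensor -> tensor := tscale (-1).
Definition tzero : tensor := \pi_tensor [::].

Lemma tensor_lift_pi (U : lmodType K) (f : {bilinear V -> W -> U}) s :
  tensor_lift f (\pi_tensor s) = eval_sum f s.
Proof.
rewrite /tensor_lift; case: piP => t /eqmodP /= /asboolP e.
by rewrite e.
Qed.

Lemma tensorP (s t : tensor) :
  (forall (U : lmodType K) (f : {bilinear V -> W -> U}),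
     tensor_lift f s = tensor_lift f t) -> s = t.
Proof.
by move=> e; rewrite -[s]reprK -[t]reprK; apply/eqmodP/asboolP => U f; apply: e.
Qed.

Lemma tensor_lift_add (U : lmodType K) (f : {bilinear V -> W -> U}) s t :
  tensor_lift f (tadd s t) = tensor_lift f s + tensor_lift f t.
Proof. by rewrite tensor_lift_pi /eval_sum big_cat. Qed.

Lemma tensor_lift_scale (U : lmodType K) (f : {bilinear V -> W -> U}) c s :
  tensor_lift f (tscale c s) = c *: tensor_lift f s.
Proof.
rewrite tensor_lift_pi /eval_sum big_map scaler_sumr.
by apply: eq_bigr => p _ /=; rewrite linearZl_LR.
Qed.

Lemma tensor_lift_zero (U : lmodType K) (f : {bilinear V -> W -> U}) :
  tensor_lift f tzero = 0.
Proof. by rewrite tensor_lift_pi /eval_sum big_nil. Qed.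

Let liftE := (tensor_lift_add, tensor_lift_scale, tensor_lift_zero).

Lemma taddA : associative tadd.
Proof. by move=> s t r; apply: tensorP => U f; rewrite !liftE addrA. Qed.
Lemma taddC : commutative tadd.
Proof. by move=> s t; apply: tensorP => U f; rewrite !liftE addrC. Qed.
Lemma tadd0 : left_id tzero tadd.
Proof. by move=> s; apply: tensorP => U f; rewrite !liftE add0r. Qed.
Lemma taddN : left_inverse tzero topp tadd.
Proof. by move=> s; apply: tensorP => U f; rewrite !liftE scaleN1r addNr. Qed.

HB.instance Definition _ :=
  GRing.isZmodule.Build tensor taddA taddC tadd0 taddN.

Lemma tscaleA a b s : tscale a (tscale b s) = tscale (a * b) s.
Proof. by apply: tensorP => U f; rewrite !liftE scalerA. Qed.
Lemma tscale1 : left_id 1 tscale.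
Proof. by move=> s; apply: tensorP => U f; rewrite !liftE scale1r. Qed.
Lemma tscaleDr : right_distributive tscale +%R.
Proof. by move=> a s t; apply: tensorP => U f; rewrite !liftE scalerDr. Qed.
Lemma tscaleDl s : {morph tscale^~ s : a b / a + b}.
Proof. by move=> a b; apply: tensorP => U f; rewrite !liftE scalerDl. Qed.

HB.instance Definition _ :=
  GRing.Zmodule_isLmodule.Build K tensor tscaleA tscale1 tscaleDr tscaleDl.

Lemma tensor_liftE (U : lmodType K) (f : {bilinear V -> W -> U}) v w :
  tensor_lift f (tens v w) = f v w.
Proof. by rewrite tensor_lift_pi /eval_sum big_seq1. Qed.

Lemma tensor_lift_linear (U : lmodType K) (f : {bilinear V -> W -> U}) :
  linear (tensor_lift f).
Proof. by move=> c s t; rewrite tensor_lift_add tensor_lift_scale. Qed.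

Lemma tens_bilinear : bilinear_for *:%R *:%R tens.
Proof.
split=> [w|v] c x y; apply: tensorP => U f.
  by rewrite tensor_lift_linear !tensor_liftE linearPl.
by rewrite tensor_lift_linear !tensor_liftE linearPr.
Qed.

HB.instance Definition _ :=
  bilinear_isBilinear.Build K V W tensor *:%R *:%R tens tens_bilinear.

Lemma tensor_sumE (t : tensor) : t = \sum_(p <- repr t) tens p.1 p.2.
Proof.
apply: tensorP => U f; rewrite {1}/tensor_lift /eval_sum.
elim: (repr t) => [|p s IHs]; first by rewrite !big_nil tensor_lift_zero.
by rewrite !big_cons tensor_lift_add tensor_liftE IHs.
Qed.

Lemma tensor_ind (P : tensor -> Prop) :
  P 0 -> (forall v w, P (tens v w)) -> (forall s t, P s -> P t -> P (s + t)) ->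
  forall t, P t.
Proof.
move=> P0 Ptens PD t; rewrite (tensor_sumE t).
by elim/big_rec: _ => // p x _ Px; apply: PD.
Qed.

End Tensor.

Notation "x \ox y" := (tens x y) (at level 40, left associativity) : ring_scope.

(* Unital and counital bialgebras. The last argument of tensor_lift is always *)
(* a coproduct, so that \sum_(x) F x_(1) x_(2) in Sweedler notation is        *)
(* tensor_lift F (delta x). Coassociativity is stated in H (x) (H (x) H),     *)
(* multiplicativity of delta is delta (x * y) = \sum x_(1) y_(1) (x) x_(2)    *)
(* y_(2).                                                                     *)
HB.mixin Record isBialgebra (K : fieldType) (H : Type) of GRing.Algebra K H := {
  delta : {linear H -> tensor H H};
  counit : {scalar H};
  deltaA : forall x : H,
    tensor_lift (fun x1 x2 : H => x1 \ox delta x2) (delta x) =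
    tensor_lift (fun x1 x2 : H =>
      tensor_lift (fun x11 x12 : H => x11 \ox (x12 \ox x2)) (delta x1))
      (delta x);
  counitl : forall x : H,
    tensor_lift (fun x1 x2 : H => counit x1 *: x2) (delta x) = x;
  counitr : forall x : H,
    tensor_lift (fun x1 x2 : H => counit x2 *: x1) (delta x) = x;
  delta1 : delta 1 = 1 \ox 1;
  deltaM : forall x y : H,
    delta (x * y) =
    tensor_lift (fun x1 x2 : H =>
      tensor_lift (fun y1 y2 : H => (x1 * y1) \ox (x2 * y2)) (delta y))
      (delta x);
  counit1 : counit 1 = 1;
  counitM : forall x y : H, counit (x * y) = counit x * counit y
}.

#[short(type="bialgType")]
HB.structure Definition Bialgebra (K : fieldType) :=
  {H of isBialgebra K H & GRing.Algebra K H}.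

Definition sweedler (K : fieldType) (H : bialgType K) (U : lmodType K)
    (F : H -> H -> U) (x : H) : U :=
  tensor_lift F (delta x).

(* Associative algebras, not assumed unital or nonzero (algType is both).     *)
HB.mixin Record isAssocAlg (K : fieldType) (A : Type) of GRing.Lmodule K A := {
  amul : A -> A -> A;
  amul_bilinear : bilinear_for *:%R *:%R amul;
  amulA : associative amul
}.

#[short(type="assocAlgType")]
HB.structure Definition AssocAlg (K : fieldType) :=
  {A of isAssocAlg K A & GRing.Lmodule K A}.

HB.instance Definition _ (K : fieldType) (A : assocAlgType K) :=
  bilinear_isBilinear.Build K A A A *:%R *:%R amul amul_bilinear.

Notation "a ** b" := (amul a b) (at level 40, left associativity) : ring_scope.

Section Hochschild.
Variables (K : fieldType) (A : assocAlgType K).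

Definition multilinear n (f : ('I_n -> A) -> A) : Prop :=
  forall (i : 'I_n) (a : 'I_n -> A),
    linear (fun c : A => f (fun j => if j == i then c else a j)).

(* (a_0, ..., a_n) |-> (a_0, ..., a_i a_(i+1), ..., a_n)                      *)
Definition merge n (i : 'I_n) (a : 'I_n.+1 -> A) (j : 'I_n) : A :=
  if (j < i)%N then a (widen_ord (leqnSn n) j)
  else if j == i then a (widen_ord (leqnSn n) j) ** a (lift ord0 j)
  else a (lift ord0 j).

Definition hochschild_d n (f : ('I_n -> A) -> A) (a : 'I_n.+1 -> A) : A :=
  a ord0 ** f (fun j => a (lift ord0 j))
  + \sum_(i < n) (-1) ^+ i.+1 *: f (merge i a)
  + (-1) ^+ n.+1 *: (f (fun j => a (widen_ord (leqnSn n) j)) ** a ord_max).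

Definition hochschild_cocycle n (f : ('I_n -> A) -> A) : Prop :=
  multilinear f /\ forall a, hochschild_d f a = 0.

Definition hochschild_coboundary n : (('I_n -> A) -> A) -> Prop :=
  match n with
  | 0 => fun f => forall a, f a = 0
  | m.+1 => fun f => exists g : ('I_m -> A) -> A,
      multilinear g /\ forall a, f a = hochschild_d g a
  end.

Definition hochschild_trivial n : Prop :=
  forall f : ('I_n -> A) -> A, hochschild_cocycle f -> hochschild_coboundary f.

Definition args1 (a : A) : 'I_1 -> A := fun _ => a.
Definition args2 (a b : A) : 'I_2 -> A := fun i => nth 0 [:: a; b] i.
Definition args3 (a b c : A) : 'I_3 -> A := fun i => nth 0 [:: a; b; c] i.

Lemma hochschild_d1E (f : ('I_1 -> A) -> A) a b :
  hochschild_d f (args2 a b) =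
  a ** f (args1 b) - f (args1 (a ** b)) + f (args1 a) ** b.
Proof.
rewrite /hochschild_d big_ord1 /= expr1 scaleN1r expr2 mulrNN mulr1 scale1r.
by congr (_ ** f _ - f _ + f _ ** _); apply/funext => j; rewrite [j]ord1.
Qed.

Lemma hochschild_d2E (f : ('I_2 -> A) -> A) a b c :
  hochschild_d f (args3 a b c) =
  a ** f (args2 b c) - f (args2 (a ** b) c) + f (args2 a (b ** c))
  - f (args2 a b) ** c.
Proof.
rewrite /hochschild_d big_ord_recl big_ord1 /= expr1 scaleN1r.
rewrite (_ : (-1) ^+ _ = 1 :> K); last by rewrite expr2 mulrNN mulr1.
rewrite (_ : (-1) ^+ 3 = -1 :> K); last by rewrite exprS expr2 mulrNN !mulr1.
rewrite scale1r scaleN1r !addrA.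
by congr (_ ** f _ - f _ + f _ - f _ ** _); apply/funext;
  case=> -[|[|//]] ?.
Qed.

End Hochschild.

Section ModuleAlgebra.
Variables (K : fieldType) (H : bialgType K) (A : assocAlgType K).

(* Hom(H, End A) is the type {bilinear H -> A -> A}.                          *)
Definition module_algebra (lam : {bilinear H -> A -> A}) : Prop :=
  (forall (x y : H) (a : A), lam (x * y) a = lam x (lam y a)) /\
  (forall (x : H) (a b : A),
     lam x (a ** b) = sweedler (fun x1 x2 => lam x1 a ** lam x2 b) x).

Definition derivation (phi : {linear A -> A}) : Prop :=
  forall a b : A, phi (a ** b) = phi a ** b + a ** phi b.

Section Complex.
Variable lam : {bilinear H -> A -> A}.

Definition d0 (phi : {linear A -> A}) (x : H) (a : A) : A :=
  lam x (phi a) - phi (lam x a).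

Definition d10 (psi : {bilinear H -> A -> A}) (x y : H) (a : A) : A :=
  lam x (psi y a) - psi (x * y) a + psi x (lam y a).

Definition d11 (psi : {bilinear H -> A -> A}) (x : H) (a b : A) : A :=
  sweedler (fun x1 x2 => lam x1 a ** psi x2 b) x - psi x (a ** b)
  + sweedler (fun x1 x2 => psi x1 a ** lam x2 b) x.

Definition F1_cocycle (psi : {bilinear H -> A -> A}) : Prop :=
  (forall x y a, d10 psi x y a = 0) /\ (forall x a b, d11 psi x a b = 0).

Definition F1_coboundary (psi : {bilinear H -> A -> A}) : Prop :=
  exists2 phi : {linear A -> A},
    derivation phi & forall x a, psi x a = d0 phi x a.

Definition F1_trivial : Prop :=
  forall psi, F1_cocycle psi -> F1_coboundary psi.

Lemma F1_coboundary_cocycle psi :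
  module_algebra lam -> F1_coboundary psi -> F1_cocycle psi.
Proof.
case=> lamM lam_amul [phi phiD psiE]; split=> [x y a|x a b].
  have sub3 (u v w : A) : u - v - (u - w) + (v - w) = 0.
    by rewrite opprB -(opprB w v) [u - v + _]addrC addrA subrK subrr.
  by rewrite /d10 !psiE /d0 linearBr !lamM /= sub3.
rewrite /d11 psiE /d0 phiD linearDr /= !lam_amul.
rewrite /sweedler /tensor_lift /eval_sum raddf_sum /=.
apply/eqP; rewrite addrAC subr_eq0 -big_split -big_split -sumrB /=; apply/eqP.
apply: eq_bigr => p _; rewrite !psiE /d0 phiD.
by rewrite linearBl linearBr /= opprD addrC [in RHS]addrACA; congr (_ + _).
Qed.

End Complex.

(* A power series in t is the sequence of its coefficients; identities of     *)
(* power series are stated coefficientwise.                                   *)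
Definition deformation (lam : {bilinear H -> A -> A})
    (L : nat -> {bilinear H -> A -> A}) : Prop :=
  [/\ forall x a, L 0%N x a = lam x a,
      forall n (x y : H) (a : A),
        L n (x * y) a = \sum_(i < n.+1) L i x (L (n - i)%N y a)
    & forall n (x : H) (a b : A),
        L n x (a ** b) =
        sweedler (fun x1 x2 => \sum_(i < n.+1) L i x1 a ** L (n - i)%N x2 b) x].

Definition zero_cochain (x : H) (a : A) : A := 0.

Lemma zero_cochain_bilinear : bilinear_for *:%R *:%R zero_cochain.
Proof. by split=> ? ? ? ?; rewrite /zero_cochain /= scaler0 addr0. Qed.

HB.instance Definition _ :=
  bilinear_isBilinear.Build K H A A *:%R *:%R zero_cochain
    zero_cochain_bilinear.

Definition trivial_deformation (lam : {bilinear H -> A -> A}) (n : nat) :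
    {bilinear H -> A -> A} :=
  if n is 0 then lam else zero_cochain.

Lemma trivial_deformationP (lam : {bilinear H -> A -> A}) :
  module_algebra lam -> deformation lam (trivial_deformation lam).
Proof.
case=> lamM lam_amul; split=> // [n x y a|n x a b].
  case: n => [|n]; first by rewrite big_ord1 /= lamM.
  rewrite big1 // => -[[|i] /= ltin] _ //.
  by rewrite /zero_cochain linear0r.
case: n => [|n] /=.
  rewrite lam_amul; congr (sweedler _ x).
  by apply/funext => x1; apply/funext => x2; rewrite big_ord1.
rewrite /sweedler /tensor_lift /eval_sum big1 // => p _.
rewrite big1 // => -[[|i] /= ltin] _; first by rewrite /zero_cochain linear0r.
by rewrite /zero_cochain linear0l.
Qed.

Definition formal_automorphism (Phi : nat -> {linear A -> A}) : Prop :=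
  (forall a, Phi 0%N a = a) /\
  (forall n (a b : A),
     Phi n (a ** b) = \sum_(i < n.+1) Phi i a ** Phi (n - i)%N b).

Definition series_comp (P Q : nat -> A -> A) (n : nat) (a : A) : A :=
  \sum_(i < n.+1) P i (Q (n - i)%N a).

Definition series_id (n : nat) (a : A) : A := if n is 0 then a else 0.

Definition series_inverse (Phi Psi : nat -> {linear A -> A}) : Prop :=
  (forall n a, series_comp Psi Phi n a = series_id n a) /\
  (forall n a, series_comp Phi Psi n a = series_id n a).

(* L' = Phi^-1 L Phi, where Psi is the (unique) inverse of Phi.               *)
Definition equivalent (L L' : nat -> {bilinear H -> A -> A}) : Prop :=
  exists Phi Psi : nat -> {linear A -> A},
    [/\ formal_automorphism Phi, series_inverse Phi Psi
      & forall n (x : H) (a : A),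
          L' n x a = series_comp Psi (series_comp (fun j => L j x) Phi) n a].

Definition rigid (lam : {bilinear H -> A -> A}) : Prop :=
  forall L, deformation lam L -> equivalent L (trivial_deformation lam).

End ModuleAlgebra.

(* Main.v *)
(* A formal automorphism Phi with Lambda Phi = Phi lambda is built one
   coefficient at a time. If Phi satisfies the two conditions
   Phi(a b) = Phi(a) Phi(b) and Lambda Phi = Phi lambda in all degrees below n,
   then the degree n defect of the first is a Hochschild 2-cocycle, and a
   primitive of it corrects the n-th coefficient of Phi so that the first
   condition holds in degree n. The degree n defect of the second condition is
   then a 1-cocycle of F(A), hence d^0 of a derivation; subtracting this
   derivation from the n-th coefficient repairs the second condition and keeps
   the first. *)
From HB Require Import structures.
Require Import Defs.
From mathcomp Require Import all_boot all_order all_algebra.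
From mathcomp Require Import boolp.
Set Implicit Arguments.
Unset Strict Implicit.
Unset Printing Implicit Defensive.
Import GRing.Theory.
Local Open Scope ring_scope.

(** * Sequences built by successive choices *)

(** Stage [n] may revise terms from index [n] on but keeps the earlier ones. The diagonal of the
    stages therefore agrees with stage [n] up to index [n], and locality transports [P n] to it. *)
Lemma seq_dependent_choice (T : Type) (f0 : nat -> T)
    (P : nat -> (nat -> T) -> Prop) :
    (forall n f g, (forall i, (i <= n)%N -> f i = g i) -> P n f -> P n g) ->
    (forall n f, (forall m, (m < n)%N -> P m f) ->
       exists g, (forall i, (i < n)%N -> f i = g i) /\ P n g) ->
  exists f, forall n, P n f.
Proof.
move=> Plocal Pstep.
(* With the hypothesis on lower indices placed under the existential, the step is total and [choice]
   applies; [f0] is the default where that hypothesis fails. *)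
have stepP (nf : nat * (nat -> T)) : exists g,
    (forall m, (m < nf.1)%N -> P m nf.2) ->
    (forall i, (i < nf.1)%N -> nf.2 i = g i) /\ P nf.1 g.
  case: (pselect (forall m, (m < nf.1)%N -> P m nf.2)) => [/Pstep[g gP]|?].
    by exists g.
  by exists f0.
have [step {}stepP] := choice stepP.
pose F :=
  nat_rect (fun=> nat -> T) (step (0%N, f0)) (fun n f => step (n.+1, f)).
have FP n m : (m <= n)%N -> P m (F n).
  elim: n m => [|n IHn] m.
    by rewrite leqn0 => /eqP->; case: (stepP (0%N, f0)).
  rewrite leq_eqVlt; have [/= FS PS] := stepP (n.+1, F n) IHn.
  case/orP=> [/eqP->|ltmn]; first exact: PS.
  by apply: Plocal (IHn m ltmn) => i leim; apply: FS; apply: leq_ltn_trans ltmn.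
(* Term [i] is frozen from stage [i] on. *)
have FE k i : F (i + k)%N i = F i i.
  elim: k => [|k IHk]; rewrite ?addn0 // addnS -IHk.
  have [/= FS _] := stepP ((i + k).+1, F (i + k)%N) (FP _).
  by rewrite -FS // ltnS leq_addr.
exists (fun n => F n n) => n; apply: Plocal (FP n n _) => // i lein.
by rewrite -{1}(subnKC lein) FE.
Qed.

(** * Sums over indices of fixed total degree *)

Section Cauchy.
Variable U : zmodType.

(** With [F] an arbitrary function of two degrees, products, compositions and nested sums of series
    are all instances. *)
Definition cauchy (F : nat -> nat -> U) (n : nat) : U :=
  \sum_(i < n.+1) F i (n - i)%N.

Lemma eq_cauchy F G n : (forall i j, (i + j)%N = n -> F i j = G i j) ->
  cauchy F n = cauchy G n.
Proof.
by move=> eFG; apply: eq_bigr => i _; apply: eFG; rewrite subnKC // -ltnS.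
Qed.

Lemma cauchyB F G n :
  cauchy (fun i j => F i j - G i j) n = cauchy F n - cauchy G n.
Proof. exact: sumrB. Qed.

Lemma cauchyC F n : cauchy F n = cauchy (fun i j => F j i) n.
Proof.
rewrite /cauchy (reindex_inj rev_ord_inj); apply: eq_bigr => i _ /=.
by rewrite subSS subKn // -ltnS.
Qed.

(** Both sides sum over [i + j + k = n]. The induction splits off the terms with [i = 0] and is
    applied to [F] shifted in its first index. *)
Lemma cauchyA (F : nat -> nat -> nat -> U) n :
  cauchy (fun i => cauchy (F i)) n =
  cauchy (fun m k => cauchy (fun i j => F i j k) m) n.
Proof.
rewrite /cauchy; elim: n F => [|n IHn] F; first by rewrite !big_ord1.
rewrite big_ord_recl [RHS]big_ord_recl big_ord1 /=.
under [in RHS]eq_bigr => i _ do rewrite big_ord_recl.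
rewrite big_split /= addrA; congr (_ + _).
  by rewrite big_ord_recl.
exact: (IHn (fun i => F i.+1)).
Qed.

(** Interchange law: the grouping [(p, q), (i, j)] of four degrees becomes [(p, i), (q, j)], by
    commuting the two middle ones. *)
Lemma cauchyACA (F : nat -> nat -> nat -> nat -> U) n :
  cauchy (fun m k => cauchy (fun p q => cauchy (F p q) k) m) n =
  cauchy (fun r s => cauchy (fun p i => cauchy (fun q => F p q i) s) r) n.
Proof.
rewrite -(cauchyA (fun p q k => cauchy (F p q) k)).
rewrite -(cauchyA (fun p i s => cauchy (fun q => F p q i) s)).
apply: eq_cauchy => p s _.
rewrite (cauchyA (F p)) (cauchyA (fun i q => F p q i)).
by apply: eq_cauchy => r j _; apply: cauchyC.
Qed.

(** Isolates the top degree: a factor that vanishes below degree [n] meets only the degree [0]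
    coefficient of the other factor. *)
Lemma cauchy_eql F n :
    (forall i j, (i + j)%N = n -> (i < n)%N -> F i j = 0) ->
  cauchy F n = F n 0%N.
Proof.
move=> F0; rewrite /cauchy big_ord_recr big1 /= ?add0r ?subnn // => i _.
by apply: F0 => //; rewrite subnKC // ltnW.
Qed.

Lemma cauchy_eqr F n :
    (forall i j, (i + j)%N = n -> (j < n)%N -> F i j = 0) ->
  cauchy F n = F 0%N n.
Proof.
by move=> F0; rewrite cauchyC cauchy_eql // => i j; rewrite addnC; apply: F0.
Qed.

End Cauchy.

Lemma raddf_cauchy (U V : zmodType) (f : {additive U -> V}) F n :
  f (cauchy F n) = cauchy (fun i j => f (F i j)) n.
Proof. exact: raddf_sum. Qed.

(** * Bundling functions proved linear or bilinear *)

Section Pack.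
Variable K : fieldType.

Lemma linear_pack (V W : lmodType K) (f : V -> W) :
  linear f -> exists g : {linear V -> W}, forall v, g v = f v.
Proof.
move=> f_lin.
by exists (HB.pack_for {linear V -> W} f
  (GRing.isLinear.Build K V W *:%R f f_lin)).
Qed.

Lemma bilinear_pack (V W U : lmodType K) (f : V -> W -> U) :
    (forall w, linear (f^~ w)) -> (forall v, linear (f v)) ->
  exists g : {bilinear V -> W -> U}, forall v w, g v w = f v w.
Proof.
move=> f_linl f_linr.
have fP : bilinear_for *:%R *:%R f by split.
by exists (HB.pack_for {bilinear V -> W -> U} f
  (bilinear_isBilinear.Build K V W U *:%R *:%R f fP)).
Qed.

End Pack.

(** * Calculus of Sweedler sums *)

Section Sweedler.
Variables (K : fieldType) (H : bialgType K).

(** A Sweedler sum is a finite sum over one chosen representative of [delta x], so this rule and the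
    next ones hold for every [F], bilinear or not. *)
Lemma eq_sweedler (U : lmodType K) (F G : H -> H -> U) x :
  (forall x1 x2, F x1 x2 = G x1 x2) -> sweedler F x = sweedler G x.
Proof. by move=> eFG; apply: eq_bigr => p _. Qed.

Lemma sweedlerD (U : lmodType K) (F G : H -> H -> U) x :
  sweedler (fun x1 x2 => F x1 x2 + G x1 x2) x = sweedler F x + sweedler G x.
Proof. exact: big_split. Qed.

Lemma sweedlerB (U : lmodType K) (F G : H -> H -> U) x :
  sweedler (fun x1 x2 => F x1 x2 - G x1 x2) x = sweedler F x - sweedler G x.
Proof. exact: sumrB. Qed.

Lemma linear_sweedler (U V : lmodType K) (f : {linear U -> V})
    (F : H -> H -> U) x :
  f (sweedler F x) = sweedler (fun x1 x2 => f (F x1 x2)) x.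
Proof. exact: raddf_sum. Qed.

Lemma sweedler_cauchy (U : lmodType K) (F : H -> H -> nat -> nat -> U) n x :
  sweedler (fun x1 x2 => cauchy (F x1 x2) n) x =
  cauchy (fun i j => sweedler (fun x1 x2 => F x1 x2 i j) x) n.
Proof. exact: exchange_big. Qed.

End Sweedler.

(** * Power series of endomorphisms: inverses and multiplicativity *)

Section Series.
Variables (K : fieldType) (A : assocAlgType K).
Implicit Types (Phi Psi : nat -> {linear A -> A}) (chi : {linear A -> A}).

Definition correct Phi (n : nat) chi (i : nat) : {linear A -> A} :=
  if i == n then (Phi i \- chi : {linear A -> A}) else Phi i.

Lemma correct_lt Phi n chi i : (i < n)%N -> correct Phi n chi i = Phi i.
Proof. by move=> ltin; rewrite /correct ltn_eqF. Qed.

Lemma correctE Phi n chi i a :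
  correct Phi n chi i a = Phi i a - (if i == n then chi a else 0).
Proof. by rewrite /correct; case: eqP => _; rewrite ?subr0. Qed.

Lemma series_compE (P Q : nat -> A -> A) n a :
  series_comp P Q n a = cauchy (fun i j => P i (Q j a)) n.
Proof. by []. Qed.

(** [Psi n] enters degree [n] of the composite only through [Psi n (Phi 0 a) = Psi n a], so
    subtracting the error [chi] from it makes that degree right. *)
Lemma series_left_inverse Phi : (forall a, Phi 0%N a = a) ->
  exists Psi, forall n a, series_comp Psi Phi n a = series_id n a.
Proof.
move=> Phi0.
apply: (@seq_dependent_choice {linear A -> A} (fun=> idfun) (fun n Psi =>
  forall a, series_comp Psi Phi n a = series_id n a))
    => [n P Q ePQ PP a|n Psi _].
  rewrite -PP !series_compE; apply: eq_cauchy => i j eij.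
  by rewrite ePQ // -eij leq_addr.
have [|chi chiE] := @linear_pack K A A
    (fun a => series_comp Psi Phi n a - series_id n a).
  move=> c a b; rewrite scalerBr addrACA -opprD; congr (_ - _).
    rewrite /series_comp scaler_sumr -big_split; apply: eq_bigr => i _ /=.
    by rewrite !linearP.
  by case: n; rewrite /= ?scaler0 ?addr0.
exists (correct Psi n chi); split=> [i /correct_lt -> // | a].
transitivity (series_comp Psi Phi n a - chi a); last by rewrite chiE subKr.
transitivity (cauchy (fun i j =>
    Psi i (Phi j a) - (if i == n then chi (Phi j a) else 0)) n).
  by rewrite series_compE; apply: eq_cauchy => i j _; rewrite correctE.
rewrite cauchyB; congr (_ - _).
by rewrite cauchy_eql ?eqxx ?Phi0 // => i j _ /ltn_eqF->.
Qed.

(** The left inverse [Psi] has a left inverse [Phi'] in turn, and [Phi' = Phi' Psi Phi = Phi]; hence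
    [Psi] is two-sided. *)
Lemma series_inverse_exists Phi : (forall a, Phi 0%N a = a) ->
  exists Psi, series_inverse Phi Psi.
Proof.
move=> Phi0; have [Psi PsiK] := series_left_inverse Phi0.
have Psi0 a : Psi 0%N a = a.
  by have := PsiK 0%N a; rewrite /series_comp big_ord1 Phi0.
have [Phi' Phi'K] := series_left_inverse Psi0.
have Phi'E n a : Phi' n a = Phi n a.
  transitivity (cauchy (fun i k => Phi' i (series_comp Psi Phi k a)) n).
    rewrite cauchy_eql => [|i [|k] <-]; rewrite ?addn0 ?ltnn // PsiK //.
    by rewrite linear0.
  transitivity (cauchy (fun m l => series_comp Phi' Psi m (Phi l a)) n).
    rewrite -(cauchyA (fun i j l => Phi' i (Psi j (Phi l a)))).
    by apply: eq_cauchy => i k _; apply: raddf_cauchy.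
  by rewrite cauchy_eqr => [|[|m] l <-]; rewrite ?add0n ?ltnn // Phi'K.
exists Psi; split=> // n a; rewrite -Phi'K !series_compE.
by apply: eq_cauchy => i j _; rewrite Phi'E.
Qed.

Definition mul_defect Phi n a b : A :=
  cauchy (fun i j => Phi i a ** Phi j b) n - Phi n (a ** b).

Lemma mul_defect_linearl Phi n b : linear (fun a => mul_defect Phi n a b).
Proof.
move=> c a a'; rewrite /mul_defect scalerBr addrACA -opprD.
congr (_ - _); last by rewrite linearPl linearP.
rewrite /cauchy scaler_sumr -big_split; apply: eq_bigr => i _ /=.
by rewrite linearP linearPl.
Qed.

Lemma mul_defect_linearr Phi n a : linear (mul_defect Phi n a).
Proof.
move=> c b b'; rewrite /mul_defect scalerBr addrACA -opprD.
congr (_ - _); last by rewrite linearPr linearP.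
rewrite /cauchy scaler_sumr -big_split; apply: eq_bigr => i _ /=.
by rewrite linearP linearPr.
Qed.

(** The change is the Hochschild coboundary of [chi]. Since [0 < n], the indices [i] and [j] cannot
    both equal [n], so no term [chi a ** chi b] appears. *)
Lemma mul_defect_correct Phi n chi a b :
    (forall c, Phi 0%N c = c) -> (0 < n)%N ->
  mul_defect (correct Phi n chi) n a b =
  mul_defect Phi n a b - (a ** chi b - chi (a ** b) + chi a ** b).
Proof.
move=> Phi0 n0; rewrite /mul_defect correctE eqxx.
transitivity (cauchy (fun i j => Phi i a ** Phi j b
      - (if j == n then Phi i a ** chi b else 0)
      - (if i == n then chi a ** Phi j b else 0)) n
    - (Phi n (a ** b) - chi (a ** b))).
  congr (_ - _); apply: eq_cauchy => i j eij; rewrite !correctE.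
  case: (i =P n) (j =P n) => [ei|_] [ej|_];
    rewrite ?subr0 ?linearBl ?linearBr //.
  by move: eij n0; rewrite ei ej -[RHS]addn0 => /addnI->.
rewrite !cauchyB.
have -> : cauchy (fun i j => if j == n then Phi i a ** chi b else 0) n
    = a ** chi b.
  by rewrite cauchy_eqr ?eqxx ?Phi0 // => i j _ /ltn_eqF->.
have -> : cauchy (fun i j => if i == n then chi a ** Phi j b else 0) n
    = chi a ** b.
  by rewrite cauchy_eql ?eqxx ?Phi0 // => i j _ /ltn_eqF->.
by rewrite !opprD !opprK !addrA [LHS](ACl (1*4*2*5*3)).
Qed.

(** For the series [D(a,b) = Phi(a) Phi(b) - Phi(ab)], associativity gives [Phi(a) D(b,c) - D(ab,c)
    + D(a,bc) - D(a,b) Phi(c) = 0]. As [D] vanishes below degree [n], the outer factors reduce to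
    [a] and [c] in degree [n]. *)
Lemma mul_defect_cocycle Phi n a b c :
    (forall d, Phi 0%N d = d) ->
    (forall m, (m < n)%N -> forall d e, mul_defect Phi m d e = 0) ->
  a ** mul_defect Phi n b c - mul_defect Phi n (a ** b) c
  + mul_defect Phi n a (b ** c) - mul_defect Phi n a b ** c = 0.
Proof.
move=> Phi0 Phi_lt.
have -> : a ** mul_defect Phi n b c =
    cauchy (fun i j => Phi i a ** mul_defect Phi j b c) n.
  by rewrite cauchy_eqr ?Phi0 // => i j _ /Phi_lt->; rewrite linear0r.
have -> : mul_defect Phi n a b ** c =
    cauchy (fun i j => mul_defect Phi i a b ** Phi j c) n.
  by rewrite cauchy_eql ?Phi0 // => i j _ /Phi_lt->; rewrite linear0l.
transitivity (
    cauchy (fun i s => cauchy (fun j k => Phi i a ** (Phi j b ** Phi k c)) s) n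
  - cauchy (fun i j => Phi i a ** Phi j (b ** c)) n
  - mul_defect Phi n (a ** b) c + mul_defect Phi n a (b ** c)
  - (cauchy (fun r k => cauchy (fun i j => Phi i a ** Phi j b ** Phi k c) r) n
     - cauchy (fun i j => Phi i (a ** b) ** Phi j c) n)).
  rewrite -!cauchyB; congr (_ - _ + _ - _); apply: eq_cauchy => i j _.
    by rewrite linearBr raddf_cauchy.
  rewrite linearBl; congr (_ - _).
  exact: (raddf_cauchy (applyr amul (Phi j c))).
rewrite (cauchyA (fun i j k => Phi i a ** (Phi j b ** Phi k c))).
under eq_cauchy => r k _ do under eq_cauchy => i j _ do rewrite amulA.
rewrite /mul_defect amulA.
move: (cauchy _ n) (cauchy _ n) (cauchy _ n) (Phi n _) => Z Y X W.
(* The eight terms form four cancelling pairs. *)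
rewrite !opprB !addrA [LHS](ACl ((1*8)*(2*5)*((3*6)*(4*7)))).
by rewrite /= !subrr !addNr !addr0.
Qed.

Lemma mul_correction Phi n :
    hochschild_trivial A 2 ->
    (forall d, Phi 0%N d = d) -> (0 < n)%N ->
    (forall m, (m < n)%N -> forall d e, mul_defect Phi m d e = 0) ->
  exists chi, forall a b, mul_defect (correct Phi n chi) n a b = 0.
Proof.
move=> HH2 Phi0 n0 Phi_lt.
pose f (v : 'I_2 -> A) := mul_defect Phi n (v ord0) (v ord_max).
have [|g [g_lin gE]] := HH2 f.
  split=> [i v|v].
    case: (boolP (i == ord0)) => [/eqP->|i0].
      exact: mul_defect_linearl.
    have -> : i = ord_max by apply: val_inj; case: i i0 => -[|[]].
    exact: mul_defect_linearr.
  have -> : v = args3 (v ord0) (v (lift ord0 ord0)) (v ord_max).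
    apply/funext => -[[|[|[|//]]] ltm] /=; congr v; exact: val_inj.
  by rewrite hochschild_d2E; apply: mul_defect_cocycle.
have [c a b|chi chiE] := @linear_pack K A A (fun a => g (args1 a)).
  have := g_lin ord0 (args1 0) c a b.
  have argsE d :
      (fun j : 'I_1 => if j == ord0 then d else args1 (0 : A) j) = args1 d.
    by apply/funext => j; rewrite [j]ord1.
  by rewrite !argsE.
exists chi => a b; rewrite mul_defect_correct // !chiE -hochschild_d1E -gE.
exact: subrr.
Qed.

End Series.

(** * Intertwining [lam] with its deformation *)

Section Intertwining.
Variables (K : fieldType) (H : bialgType K) (A : assocAlgType K).
Variables (lam : {bilinear H -> A -> A}) (L : nat -> {bilinear H -> A -> A}).
Hypotheses (hlam : module_algebra lam) (hL : deformation lam L).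
Implicit Types (Phi : nat -> {linear A -> A}) (chi : {linear A -> A}).

Let L0 x a : L 0%N x a = lam x a. Proof. by case: hL. Qed.

Definition act_defect Phi n x a : A :=
  cauchy (fun i j => L i x (Phi j a)) n - Phi n (lam x a).

Lemma act_defect_linearl Phi n a : linear (fun x => act_defect Phi n x a).
Proof.
move=> c x y; rewrite /act_defect scalerBr addrACA -opprD.
congr (_ - _); last by rewrite linearPl linearP.
rewrite /cauchy scaler_sumr -big_split; apply: eq_bigr => i _ /=.
by rewrite linearPl.
Qed.

Lemma act_defect_linearr Phi n x : linear (act_defect Phi n x).
Proof.
move=> c a b; rewrite /act_defect scalerBr addrACA -opprD.
congr (_ - _); last by rewrite linearPr linearP.
rewrite /cauchy scaler_sumr -big_split; apply: eq_bigr => i _ /=.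
by rewrite linearP linearPr.
Qed.

(** The defect is linear in [Phi], and [chi] meets only [L 0 = lam], which yields exactly [d0]. *)
Lemma act_defect_correct Phi n chi x a :
  act_defect (correct Phi n chi) n x a =
  act_defect Phi n x a - d0 lam chi x a.
Proof.
rewrite /act_defect correctE eqxx.
transitivity (cauchy (fun i j => L i x (Phi j a)
      - (if j == n then L i x (chi a) else 0)) n
    - (Phi n (lam x a) - chi (lam x a))).
  congr (_ - _); apply: eq_cauchy => i j _; rewrite correctE.
  by case: eqP => _; rewrite ?subr0 // linearBr.
rewrite cauchyB.
have -> : cauchy (fun i j => if j == n then L i x (chi a) else 0) n
    = lam x (chi a).
  by rewrite cauchy_eqr ?eqxx ?L0 // => i j _ /ltn_eqF->.
by rewrite /d0 !opprD !opprK !addrA [LHS](ACl (1*3*2*4)).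
Qed.

(** For the series [E(x,a) = L(x) Phi(a) - Phi(lam(x) a)], multiplicativity of [L] and [lam] gives
    [L(x) E(y,a) - E(xy,a) + E(x,lam(y) a) = 0]. In degree [n] only [L 0 = lam] survives in front of
    [E]. *)
Lemma act_defect_d10 Phi n x y a :
    (forall m, (m < n)%N -> forall z b, act_defect Phi m z b = 0) ->
  lam x (act_defect Phi n y a) - act_defect Phi n (x * y) a
  + act_defect Phi n x (lam y a) = 0.
Proof.
move=> Phi_lt; have [_ LM _] := hL.
have -> : lam x (act_defect Phi n y a) =
    cauchy (fun i j => L i x (act_defect Phi j y a)) n.
  by rewrite cauchy_eqr ?L0 // => i j _ /Phi_lt->; rewrite linear0r.
transitivity (
    cauchy (fun i s => cauchy (fun j k => L i x (L j y (Phi k a))) s) n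
  - cauchy (fun i j => L i x (Phi j (lam y a))) n
  - act_defect Phi n (x * y) a + act_defect Phi n x (lam y a)).
  rewrite -!cauchyB; congr (_ - _ + _); apply: eq_cauchy => i j _.
  by rewrite linearBr raddf_cauchy.
rewrite (cauchyA (fun i j k => L i x (L j y (Phi k a)))).
rewrite /act_defect hlam.1.
have -> : cauchy (fun i j => L i (x * y) (Phi j a)) n =
    cauchy (fun m k => cauchy (fun i j => L i x (L j y (Phi k a))) m) n.
  by apply: eq_cauchy => m k _; rewrite LM.
move: (cauchy _ n) (cauchy _ n) (Phi n _) => X Y W.
by rewrite !opprB !addrA [LHS](ACl ((1*4)*(2*5)*(3*6))) /= !subrr !addNr !addr0.
Qed.

(** Multiplicativity of [Phi] through degree [n] writes both parts of the defect at [a ** b] as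
    Sweedler sums of products. Their difference is split by [XY - X'Y' = X(Y - Y') + (X - X')Y']. *)
Lemma act_defect_d11 Phi n x a b :
    (forall d, Phi 0%N d = d) ->
    (forall m, (m <= n)%N -> forall d e, mul_defect Phi m d e = 0) ->
    (forall m, (m < n)%N -> forall z d, act_defect Phi m z d = 0) ->
  sweedler (fun x1 x2 => lam x1 a ** act_defect Phi n x2 b) x
  - act_defect Phi n x (a ** b)
  + sweedler (fun x1 x2 => act_defect Phi n x1 a ** lam x2 b) x = 0.
Proof.
move=> Phi0 PhiM Phi_lt; have [_ _ LD] := hL.
have {}PhiM m d e : (m <= n)%N ->
    Phi m (d ** e) = cauchy (fun i j => Phi i d ** Phi j e) m.
  by move=> /PhiM/(_ d e)/eqP; rewrite subr_eq0 => /eqP.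
pose LP y c r := cauchy (fun i j => L i y (Phi j c)) r.
pose Pl y c r := Phi r (lam y c).
have defectE r y c : act_defect Phi r y c = LP y c r - Pl y c r by [].
have LPE : LP x (a ** b) n =
    sweedler (fun x1 x2 => cauchy (fun r s => LP x1 a r ** LP x2 b s) n) x.
  transitivity (cauchy (fun m k => cauchy (fun i j =>
      sweedler (fun x1 x2 =>
        cauchy (fun p q => L p x1 (Phi i a) ** L q x2 (Phi j b)) m) x) k) n).
    apply: eq_cauchy => m k ek.
    rewrite PhiM ?raddf_cauchy; last by rewrite -ek leq_addl.
    by apply: eq_cauchy => i j _; apply: LD.
  transitivity (sweedler (fun x1 x2 => cauchy (fun m k => cauchy (fun i j =>
      cauchy (fun p q => L p x1 (Phi i a) ** L q x2 (Phi j b)) m) k) n) x).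
    rewrite [RHS]sweedler_cauchy; apply: eq_cauchy => m k _.
    by rewrite [RHS]sweedler_cauchy.
  apply: eq_sweedler => x1 x2.
  transitivity (cauchy (fun m k => cauchy (fun p q => cauchy (fun i j =>
      L p x1 (Phi i a) ** L q x2 (Phi j b)) k) m) n).
    by apply: eq_cauchy => m k _; apply: exchange_big.
  (* Regrouping by [(p, i)] and [(q, j)] separates the factors [LP x1 a] and [LP x2 b]. *)
  rewrite (cauchyACA (fun p q i j => L p x1 (Phi i a) ** L q x2 (Phi j b))).
  apply: eq_cauchy => r s _.
  apply/esym/(etrans (raddf_cauchy (applyr amul (LP x2 b s)) _ _)).
  by apply: eq_cauchy => p i _; apply: raddf_cauchy.
have PlE : Pl x (a ** b) n =
    sweedler (fun x1 x2 => cauchy (fun r s => Pl x1 a r ** Pl x2 b s) n) x.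
  rewrite /Pl hlam.2 linear_sweedler; apply: eq_sweedler => x1 x2.
  exact: PhiM.
rewrite [act_defect Phi n x _]defectE LPE PlE -sweedlerB.
rewrite addrAC -sweedlerD -sweedlerB.
(* The identity already holds for each summand of the coproduct. *)
rewrite [LHS]big1 // => p _ /=; move: p.1 p.2 => x1 x2.
have -> : lam x1 a ** act_defect Phi n x2 b =
    cauchy (fun r s => LP x1 a r ** act_defect Phi s x2 b) n.
  rewrite cauchy_eqr => [|i j _ /Phi_lt->]; last by rewrite linear0r.
  by rewrite /LP /cauchy big_ord1 L0 Phi0.
have -> : act_defect Phi n x1 a ** lam x2 b =
    cauchy (fun r s => act_defect Phi r x1 a ** Pl x2 b s) n.
  by rewrite cauchy_eql ?/Pl ?Phi0 // => i j _ /Phi_lt->; rewrite linear0l.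
transitivity (
  cauchy (fun r s => LP x1 a r ** LP x2 b s) n
  - cauchy (fun r s => LP x1 a r ** Pl x2 b s) n
  + (cauchy (fun r s => LP x1 a r ** Pl x2 b s) n
     - cauchy (fun r s => Pl x1 a r ** Pl x2 b s) n)
  - (cauchy (fun r s => LP x1 a r ** LP x2 b s) n
     - cauchy (fun r s => Pl x1 a r ** Pl x2 b s) n)).
  rewrite -!cauchyB; congr (_ + _ - _); apply: eq_cauchy => r s _.
    by rewrite defectE linearBr.
  by rewrite defectE linearBl.
by rewrite addrA subrK subrr.
Qed.

(** The conclusion records that [chi] is a derivation because this is what preserves
    multiplicativity in degree [n]. *)
Lemma act_correction Phi n :
    F1_trivial lam -> (forall d, Phi 0%N d = d) ->
    (forall m, (m <= n)%N -> forall d e, mul_defect Phi m d e = 0) ->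
    (forall m, (m < n)%N -> forall z d, act_defect Phi m z d = 0) ->
  exists2 chi, derivation chi &
    forall x a, act_defect (correct Phi n chi) n x a = 0.
Proof.
move=> HF1 Phi0 PhiM Phi_lt.
have [psi psiE] := bilinear_pack (act_defect_linearl Phi n)
  (act_defect_linearr Phi n).
have [|chi chiD chiE] := HF1 psi.
  split=> [x y a|x a b]; first by rewrite /d10 !psiE act_defect_d10.
  rewrite -[RHS](act_defect_d11 x a b Phi0 PhiM Phi_lt) /d11 psiE.
  by congr (_ - _ + _); apply: eq_sweedler => x1 x2; rewrite psiE.
by exists chi => // x a; rewrite act_defect_correct -chiE psiE subrr.
Qed.

Lemma intertwiner_exists :
    hochschild_trivial A 2 -> F1_trivial lam ->
  exists Phi, forall n, [/\ forall a, Phi 0%N a = a,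
    forall a b, mul_defect Phi n a b = 0 &
    forall x a, act_defect Phi n x a = 0].
Proof.
move=> HH2 HF1.
apply: (@seq_dependent_choice {linear A -> A} (fun=> idfun) (fun n Phi =>
    [/\ forall a, Phi 0%N a = a, forall a b, mul_defect Phi n a b = 0 &
        forall x a, act_defect Phi n x a = 0])).
  move=> n P Q ePQ [P0 PM PL]; split=> [a|a b|x a]; first by rewrite -ePQ.
    rewrite -(PM a b) /mul_defect ePQ //; congr (_ - _).
    by apply: eq_cauchy => i j eij; rewrite !ePQ // -eij ?leq_addr ?leq_addl.
  rewrite -(PL x a) /act_defect ePQ //; congr (_ - _).
  by apply: eq_cauchy => i j eij; rewrite !ePQ // -eij leq_addl.
(* Degree [0] is settled by the identity, since [L 0 = lam]; corrections start in degree [1], which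
   keeps the leading coefficient. *)
case=> [|n] Phi Phi_lt.
  exists (fun=> idfun); split=> //; split=> [//|a b|x a].
    by rewrite /mul_defect /cauchy big_ord1 subrr.
  by rewrite /act_defect /cauchy big_ord1 L0 subrr.
have Phi0 : forall d, Phi 0%N d = d by case: (Phi_lt 0%N).
have [|chi1 PhiM1] := mul_correction HH2 Phi0 (ltn0Sn n).
  by move=> m /Phi_lt[].
pose Phi1 := correct Phi n.+1 chi1.
have Phi1_0 d : Phi1 0%N d = d by rewrite /Phi1 correct_lt.
have Phi1M m : (m <= n.+1)%N -> forall d e, mul_defect Phi1 m d e = 0.
  rewrite leq_eqVlt => /orP[/eqP-> //|ltm] d e.
  have [_ PM _] := Phi_lt m ltm; rewrite -(PM d e) /mul_defect.
  rewrite /Phi1 correct_lt //; congr (_ - _); apply: eq_cauchy => i j eij.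
  by rewrite !correct_lt //; apply: leq_ltn_trans ltm;
    rewrite -eij ?leq_addr ?leq_addl.
have Phi1L m : (m < n.+1)%N -> forall x a, act_defect Phi1 m x a = 0.
  move=> ltm x a; have [_ _ PL] := Phi_lt m ltm; rewrite -(PL x a) /act_defect.
  rewrite /Phi1 correct_lt //; congr (_ - _); apply: eq_cauchy => i j eij.
  by rewrite correct_lt //; apply: leq_ltn_trans ltm; rewrite -eij leq_addl.
have [chi2 chi2D PhiL2] := act_correction HF1 Phi1_0 Phi1M Phi1L.
exists (correct Phi1 n.+1 chi2); split=> [i ltin|].
  by rewrite correct_lt // /Phi1 correct_lt.
split=> [a|a b|//]; first by rewrite correct_lt.
(* The Hochschild coboundary of the derivation [chi2] is zero. *)
rewrite mul_defect_correct // Phi1M // chi2D.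
by rewrite sub0r addrAC [X in X - _]addrC subrr oppr0.
Qed.

End Intertwining.

Theorem corollary3p6 (K : fieldType) (H : bialgType K) (A : assocAlgType K)
    (lam : {bilinear H -> A -> A}) (hlam : module_algebra lam)
    (HH2 : hochschild_trivial A 2%N) (HF1 : F1_trivial lam) :
  rigid lam.
Proof.
move=> L hL.
have [Phi PhiP] := intertwiner_exists hlam hL HH2 HF1.
have [Phi0 _ _] := PhiP 0%N.
have [Psi PsiK] := series_inverse_exists Phi0.
exists Phi, Psi; split=> // [|n x a].
  split=> // n a b; have [_ /(_ a b)/eqP + _] := PhiP n.
  by rewrite subr_eq0 => /eqP<-.
(* The constant series [lam] is [Psi Phi lam], and the intertwining condition turns [Phi lam] into
   [L Phi]. *)
transitivity (series_comp Psi Phi n (lam x a)).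
  by rewrite PsiK.1; case: n.
rewrite !series_compE; apply: eq_cauchy => i j _; congr (Psi i _).
by have [_ _ /(_ x a)/eqP] := PhiP j; rewrite subr_eq0 => /eqP<-.
Qed.
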